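(* Let $\mathbb{K}$ be an algebraically closed field of characteristic zero, let $f(X)\in\mathbb{K}[X]$ with $f(X)\neq 0$, and let $D=f(X)\dfrac{\partial}{\partial Y}$, a derivation of $\mathbb{K}[X,Y]$. Then \[ \operatorname{Aut}_D(\mathbb{K}[X,Y])=\{(\alpha X+\beta,\ \gamma Y+p(X))\mid \alpha,\gamma\in\mathbb{K}^*,\ \beta\in\mathbb{K},\ p\in\mathbb{K}[X],\ f(\alpha X+\beta)=\gamma f(X)\}. \]
   Context: For a derivation $D$ of $\mathbb{K}[X,Y]$, $\operatorname{Aut}_D(\mathbb{K}[X,Y])$ denotes the isotropy group of $D$: the group of all $\mathbb{K}$-algebra automorphisms $\rho$ of $\mathbb{K}[X,Y]$ with $\rho D=D\rho$. A pair $(F,G)$ of polynomials denotes the $\mathbb{K}$-algebra endomorphism $\rho$ of $\mathbb{K}[X,Y]$ with $\rho(X)=F$ and $\rho(Y)=G$. *)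

(* Defs.v *)
From HB Require Import structures.
From mathcomp Require Import all_boot all_order all_algebra.
From mathcomp Require Export mpoly.

Set Implicit Arguments.
Unset Strict Implicit.
Unset Printing Implicit Defensive.

Import GRing.Theory.
Local Open Scope ring_scope.

Record derivation (K : fieldType) (A : comAlgType K) := Derivation {
  derivation_fun :> {linear A -> A};
  derivationM : forall a b : A,
    derivation_fun (a * b) = derivation_fun a * b + a * derivation_fun b
}.

(* Morphisms are records carrying proofs, so sets of endomorphisms are
   predicates on {lrmorphism A -> A}, considered up to pointwise equality. *)
Definition isotropy_group (K : fieldType) (A : comAlgType K)
    (D : derivation A) (rho : {lrmorphism A -> A}) : Prop :=
  bijective rho /\ (forall a : A, rho (D a) = D (rho a)).

Section TwoVariables.
Variable K : fieldType.
Implicit Types (f p : {poly K}) (F G : {mpoly K[2]}).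

Definition varX : {mpoly K[2]} := 'X_(inord 0).
Definition varY : {mpoly K[2]} := 'X_(inord 1).

Definition polyInX p : {mpoly K[2]} := horner_alg varX p.

Definition pair_endo F G : {lrmorphism {mpoly K[2]} -> {mpoly K[2]}} :=
  comp_mpoly [tuple F; G].

Lemma pair_endoX F G : pair_endo F G varX = F.
Proof. by rewrite /= comp_mpolyXU /= inordK. Qed.

Lemma pair_endoY F G : pair_endo F G varY = G.
Proof. by rewrite /= comp_mpolyXU /= inordK. Qed.

Definition fdY_fun f : {linear {mpoly K[2]} -> {mpoly K[2]}} :=
  polyInX f \*o mderiv (inord 1).

Lemma fdY_funM f (a b : {mpoly K[2]}) :
  fdY_fun f (a * b) = fdY_fun f a * b + a * fdY_fun f b.
Proof. by rewrite /= mderivM mulrDr mulrA (mulrCA a). Qed.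

Definition fdY f : derivation {mpoly K[2]} := Derivation (fdY_funM f).

End TwoVariables.

(* Main.v *)
(** In characteristic zero the kernel of D = f(X) d/dY is K[X], and both an
    automorphism rho commuting with D and its inverse preserve this kernel.
    Hence rho X = l(X) with l invertible under composition, so l is affine.
    Applying rho to D Y = f gives f(l(X)) = f(X) d(rho Y)/dY; the second factor
    lies in K[X], and comparing degrees makes it a constant gamma, whence
    rho Y - gamma Y is in ker D.  Conversely, it suffices to check
    rho D = D rho on the generators X and Y. *)
Require Import Defs.
From HB Require Import structures.
From mathcomp Require Import all_boot all_order all_algebra.

Set Implicit Arguments.
Unset Strict Implicit.
Unset Printing Implicit Defensive.

Import GRing.Theory.
Local Open Scope ring_scope.

Section TwoVariables.
Variable K : fieldType.
Implicit Types (f p q : {poly K}) (a b g : {mpoly K[2]}).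
Local Notation endo := {lrmorphism {mpoly K[2]} -> {mpoly K[2]}}.

(** * Reduction to the generators X and Y *)

Lemma inord_eq01 : (inord 0 == inord 1 :> 'I_2) = false.
Proof. by rewrite -val_eqE /= !inordK. Qed.

Lemma mpolyX2E (m : 'X_{1.. 2}) :
  'X_[m] = varX K ^+ m (inord 0) * varY K ^+ m (inord 1).
Proof.
rewrite mpolyXE_id big_ord_recl big_ord1 /varX /varY.
have -> : ord0 = inord 0 :> 'I_2 by apply/val_inj; rewrite /= inordK.
by have -> : lift (inord 0) ord0 = inord 1 :> 'I_2
  by apply/val_inj; rewrite /= !inordK.
Qed.

Lemma mpoly2_ind (P : {mpoly K[2]} -> Prop) :
    P (varX K) -> P (varY K) -> P 1 ->
    (forall a b, P a -> P b -> P (a + b)) ->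
    (forall a b, P a -> P b -> P (a * b)) ->
    (forall (c : K) a, P a -> P (c *: a)) ->
  forall g, P g.
Proof.
move=> PX PY P1 PD PM PZ.
have Pexp a k : P a -> P (a ^+ k).
  by move=> Pa; elim: k => // k IHk; rewrite exprS; apply: PM.
apply: mpolyind => [|c m p _ _ Pp]; first by rewrite -(scale0r 1); apply: PZ.
by apply: PD => //; apply: PZ; rewrite mpolyX2E; apply: PM; apply: Pexp.
Qed.

Lemma eq_endo (rho sigma : endo) :
  rho (varX K) = sigma (varX K) -> rho (varY K) = sigma (varY K) ->
  rho =1 sigma.
Proof.
move=> eqX eqY; apply: mpoly2_ind => // [|a b eqa eqb|a b eqa eqb|c a eqa].
- by rewrite !rmorph1.
- by rewrite !rmorphD /= eqa eqb.
- by rewrite !rmorphM /= eqa eqb.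
- by rewrite !linearZ /= eqa.
Qed.

(** * The subalgebra K[X] and substitution in it *)

Lemma endo_polyInX (rho : endo) q :
  rho (polyInX q) = horner_alg (rho (varX K)) q.
Proof.
elim/poly_ind: q => [|q c IHq]; first by rewrite /polyInX !linear0.
rewrite /polyInX !rmorphD !rmorphM /= -/(polyInX q) IHq !horner_algX.
by rewrite !horner_algC linearZ /= rmorph1.
Qed.

Lemma horner_alg_polyInX p q : horner_alg (polyInX p) q = polyInX (q \Po p).
Proof.
elim/poly_ind: q => [|q c IHq]; first by rewrite comp_poly0 /polyInX !linear0.
rewrite comp_poly_MXaddC /polyInX !rmorphD !rmorphM /= IHq !horner_algX.
by rewrite !horner_algC.
Qed.

Lemma polyInX_inj : injective (@polyInX K).
Proof.
(* Specialising both variables to ['X] gives a left inverse. *)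
pose ev := mmap (@polyC K) (fun _ : 'I_2 => 'X).
apply: (can_inj (g := ev)) => p.
elim/poly_ind: p => [|p c IHp]; first by rewrite /polyInX linear0 /ev mmap0.
rewrite /polyInX rmorphD rmorphM /= horner_algX horner_algC /ev mmapD.
by rewrite rmorphM /= -/ev IHp /ev mmapX mmap1U -mul_mpolyC mulr1 mmapC.
Qed.

(** * The kernels of d/dY and of D *)

Lemma mderivY_polyInX p : mderiv (inord 1) (polyInX p) = 0.
Proof.
elim/poly_ind: p => [|p c IHp]; first by rewrite /polyInX !linear0.
rewrite /polyInX rmorphD rmorphM /= horner_algX horner_algC.
rewrite linearD /= mderivM IHp mul0r add0r -mul_mpolyC mulr1 mderivC addr0.
by rewrite /varX mderivX mnm1E inord_eq01 scale0r mulr0.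
Qed.

Lemma mderivY_varY : mderiv (inord 1) (varY K) = 1.
Proof.
rewrite /varY mderivX mnm1E eqxx scale1r -{1}[U_(_)%MM]add0m.
by rewrite addmK mpolyX0.
Qed.

Lemma mderivY_eq0 (charK : [pchar K] =i pred0) g :
  mderiv (inord 1) g = 0 -> exists p, g = polyInX p.
Proof.
(* The witness forgets the Y-exponents; it remains to see that they are all zero. *)
move=> dg0; exists (\sum_(m <- msupp g) g@_m *: 'X^(m (inord 0))).
rewrite /polyInX linear_sum {1}[g]mpolyE; apply: eq_big_seq => m.
rewrite mcoeff_msupp => gm_neq0.
rewrite linearZ /= rmorphXn /= horner_algX mulr_algl mpolyX2E.
case def_k: (m (inord 1)) => [|k]; first by rewrite expr0 mulr1.
case/eqP: gm_neq0.
(* If Y occurs in [m] with exponent k+1, then dg/dY has coefficient (k+1) [g@_m] at [m] divided by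
   Y, nonzero in characteristic zero. *)
have := mcoeff_mderiv (inord 1) g (m - U_(inord 1)); rewrite dg0 mcoeff0.
rewrite submK; last first.
  by apply/mnm_lepP=> i; rewrite mnm1E; case: eqP => // <-; rewrite def_k.
move/esym/eqP; rewrite -mulr_natr mulf_eq0 => /orP[/eqP //|].
by have /pcharf0P -> := charK.
Qed.

Lemma fdY_varX f : fdY f (varX K) = 0.
Proof. by rewrite /= /varX mderivX mnm1E inord_eq01 scale0r mulr0. Qed.

Lemma fdY_varY f : fdY f (varY K) = polyInX f.
Proof. by rewrite /= mderivY_varY mulr1. Qed.

Lemma fdY_eq0 (charK : [pchar K] =i pred0) f g :
  f != 0 -> fdY f g = 0 -> exists p, g = polyInX p.
Proof.
move=> f_neq0 /eqP; rewrite /= mulf_eq0 => /orP[|/eqP /(mderivY_eq0 charK) //].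
rewrite -(linear0 (@horner_alg K _ (varX K))) (inj_eq polyInX_inj).
by rewrite (negPf f_neq0).
Qed.

Lemma derivation1 (D : derivation {mpoly K[2]}) : D 1 = 0.
Proof.
apply: (addrI (D 1)); rewrite addr0.
by rewrite -[in RHS](mulr1 1) derivationM mulr1 mul1r.
Qed.

(** Both composites d are linear and satisfy d(ab) = d(a) rho(b) + rho(a) d(b), so agreement on
    generators propagates to all polynomials. *)
Lemma commute_derivation (D : derivation {mpoly K[2]}) (rho : endo) :
    rho (D (varX K)) = D (rho (varX K)) ->
    rho (D (varY K)) = D (rho (varY K)) ->
  forall g, rho (D g) = D (rho g).
Proof.
move=> cX cY; apply: mpoly2_ind => // [|a b ca cb|a b ca cb|c a ca].
- by rewrite !(rmorph1, derivation1) rmorph0.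
- by rewrite !linearD /= ca cb.
- by rewrite derivationM rmorphD !rmorphM /= derivationM ca cb.
- by rewrite !linearZ /= ca.
Qed.

(** * Images of X and Y under an element of the isotropy group *)

Lemma polyInX_affine (alpha beta : K) :
  polyInX (alpha *: 'X + beta%:P) = alpha *: varX K + beta%:MP.
Proof.
rewrite /polyInX linearD linearZ /= horner_algX horner_algC.
by rewrite mulr_algl -[_%:A]mul_mpolyC mulr1.
Qed.

Lemma affine_polyE p :
  size p = 2%N -> exists alpha beta, alpha != 0 /\ p = alpha *: 'X + beta%:P.
Proof.
move=> szp; exists p`_1, p`_0; split.
  have : lead_coef p != 0 by rewrite lead_coef_eq0 -size_poly_eq0 szp.
  by rewrite /lead_coef szp.
apply/polyP=> -[|[|i]]; rewrite coefD coefZ coefX coefC /=.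
- by rewrite mulr0 add0r.
- by rewrite mulr1 addr0.
- by rewrite mulr0 addr0 nth_default // szp.
Qed.

Lemma isotropy_varX (charK : [pchar K] =i pred0) f (rho : endo) :
    f != 0 -> isotropy_group (fdY f) rho ->
  exists alpha beta, alpha != 0 /\
    rho (varX K) = polyInX (alpha *: 'X + beta%:P).
Proof.
move=> f_neq0 [[sigma rhoK sigmaK] rhoD].
have [|p rhoX] := fdY_eq0 charK (g := rho (varX K)) f_neq0.
  by rewrite -rhoD fdY_varX rmorph0.
have [|q sigmaX] := fdY_eq0 charK (g := sigma (varX K)) f_neq0.
  by apply: (can_inj rhoK); rewrite rhoD sigmaK fdY_varX rmorph0.
(* This is rho(sigma X) = X read in K[X], where [rho] acts as substitution of [p]. *)
have qp : q \Po p = 'X.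
  apply: polyInX_inj; rewrite -horner_alg_polyInX -rhoX -endo_polyInX -sigmaX.
  by rewrite sigmaK /polyInX horner_algX.
have /affine_polyE[alpha [beta [alpha_neq0 def_p]]] : size p = 2%N.
  (* Degrees multiply under composition, so deg q * deg p = 1. *)
  have := size_comp_poly q p; rewrite qp size_polyX /= => /esym/eqP.
  by rewrite muln_eq1 => /andP[_]; case: (size p) => [|k] //= /eqP->.
by exists alpha, beta; rewrite rhoX def_p.
Qed.

Lemma isotropy_varY (charK : [pchar K] =i pred0) f (rho : endo) alpha beta :
    f != 0 -> alpha != 0 -> isotropy_group (fdY f) rho ->
    rho (varX K) = polyInX (alpha *: 'X + beta%:P) ->
  exists gamma p, [/\ gamma != 0, f \Po (alpha *: 'X + beta%:P) = gamma *: f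
    & rho (varY K) = gamma *: varY K + polyInX p].
Proof.
move=> f_neq0 alpha_neq0 [_ rhoD] rhoX; set l := alpha *: 'X + _ in rhoX *.
have sz_l : size l = 2%N.
  rewrite /l -mul_polyC size_MXaddC polyC_eq0 (negPf alpha_neq0) size_polyC.
  by rewrite alpha_neq0.
have fl : polyInX (f \Po l) = polyInX f * mderiv (inord 1) (rho (varY K)).
  by rewrite -horner_alg_polyInX -rhoX -endo_polyInX -[in LHS]fdY_varY rhoD.
(* Differentiating [fl] in Y kills the left side and leaves f times the second Y-derivative of rho
   Y. *)
have [|c def_c] := fdY_eq0 charK (g := mderiv (inord 1) (rho (varY K))) f_neq0.
  apply/eqP; have /eqP := mderivY_polyInX (f \Po l).
  by rewrite fl mderivM mderivY_polyInX mul0r add0r.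
have flc : f \Po l = f * c.
  by apply: polyInX_inj; rewrite fl def_c /polyInX rmorphM.
have fl_neq0 : f \Po l != 0 by rewrite comp_poly2_eq0.
have c_neq0 : c != 0 by apply: contraNneq fl_neq0 => c0; rewrite flc c0 mulr0.
have /size_poly1P[gamma gamma_neq0 def_gamma] : size c == 1%N.
  (* Substituting the degree-one [l] preserves the degree of f, so [c] has degree 0. *)
  have := size_comp_poly2 f sz_l; rewrite flc size_mul //.
  rewrite -(prednK (n := size f)) ?size_poly_gt0 // addSn /= -addn1 => /eqP.
  by rewrite eqn_add2l.
have [|p def_p] := mderivY_eq0 charK (g := rho (varY K) - gamma *: varY K).
  rewrite linearB linearZ /= mderivY_varY def_c def_gamma /polyInX horner_algC.
  by rewrite subrr.
exists gamma, p; split=> //; first by rewrite flc def_gamma mulrC mul_polyC.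
by rewrite -def_p addrC subrK.
Qed.

(** * Invertibility of the triangular endomorphisms *)

Lemma pair_endo_triangular_can (alpha beta gamma alpha' beta' gamma' : K) p p' :
    alpha * alpha' = 1 -> alpha' * beta + beta' = 0 -> gamma * gamma' = 1 ->
    gamma' *: p + (p' \Po (alpha *: 'X + beta%:P)) = 0 ->
  cancel (pair_endo (alpha' *: varX K + beta'%:MP)
                    (gamma' *: varY K + polyInX p'))
         (pair_endo (alpha *: varX K + beta%:MP)
                    (gamma *: varY K + polyInX p)).
Proof.
move=> alphaK betaK gammaK pK.
(* The hypotheses are the coefficient conditions for rho(sigma X) = X and rho(sigma Y) = Y. *)
set sigma := pair_endo _ _; set rho := pair_endo _ _.
have rhoX : rho (varX K) = polyInX (alpha *: 'X + beta%:P).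
  by rewrite pair_endoX polyInX_affine.
have rhoY : rho (varY K) = gamma *: varY K + polyInX p by rewrite pair_endoY.
have sigmaX : sigma (varX K) = alpha' *: varX K + beta'%:MP.
  by rewrite pair_endoX.
have sigmaY : sigma (varY K) = gamma' *: varY K + polyInX p'.
  by rewrite pair_endoY.
have rho_sigmaX : rho (sigma (varX K)) = varX K.
  rewrite sigmaX -polyInX_affine endo_polyInX rhoX horner_alg_polyInX.
  rewrite comp_polyD comp_polyZ comp_polyX comp_polyC scalerDr scalerA.
  rewrite [alpha' * _]mulrC alphaK scale1r -addrA -mul_polyC -polyCM -polyCD.
  by rewrite betaK addr0 /polyInX horner_algX.
have rho_sigmaY : rho (sigma (varY K)) = varY K.
  rewrite sigmaY linearD linearZ /= -/rho rhoY endo_polyInX rhoX.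
  rewrite horner_alg_polyInX scalerDr scalerA [gamma' * _]mulrC gammaK scale1r.
  have := congr1 (@polyInX K) pK.
  rewrite /polyInX linearD linearZ linear0 /= mulr_algl => pK'.
  by rewrite -addrA pK' addr0.
by apply: (eq_endo (rho := rho \o sigma) (sigma := idfun)).
Qed.

Lemma pair_endo_triangular_bij (alpha beta gamma : K) p :
    alpha != 0 -> gamma != 0 ->
  bijective (pair_endo (alpha *: varX K + beta%:MP)
                       (gamma *: varY K + polyInX p)).
Proof.
(* Solving for X and Y, the inverse sends X to (X - beta)/alpha and Y to (Y - p((X -
   beta)/alpha))/gamma. *)
move=> alpha_neq0 gamma_neq0; pose beta' := - (alpha^-1 * beta).
pose p' := - (gamma^-1 *: (p \Po (alpha^-1 *: 'X + beta'%:P))).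
exists (pair_endo (alpha^-1 *: varX K + beta'%:MP)
                  (gamma^-1 *: varY K + polyInX p')).
  apply: pair_endo_triangular_can; rewrite ?mulVf //.
    by rewrite /beta' mulrN mulVKf // addNr.
  by rewrite /p' scalerN scalerA mulfV // scale1r addNr.
apply: pair_endo_triangular_can; rewrite ?mulfV ?addrN //.
have l'K : (alpha^-1 *: 'X + beta'%:P) \Po (alpha *: 'X + beta%:P) = 'X.
  rewrite comp_polyD comp_polyZ comp_polyX comp_polyC scalerDr scalerA mulVf //.
  by rewrite scale1r -addrA -mul_polyC -polyCM -polyCD addrN addr0.
by rewrite /p' raddfN /= comp_polyZ -comp_polyA l'K comp_polyXr addrN.
Qed.

End TwoVariables.

Theorem theorem3p3 (K : closedFieldType) (charK : [pchar K] =i pred0)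
    (f : {poly K}) (f_neq0 : f != 0)
    (rho : {lrmorphism {mpoly K[2]} -> {mpoly K[2]}}) :
  isotropy_group (fdY f) rho <->
  exists (alpha beta gamma : K) (p : {poly K}),
    [/\ alpha != 0, gamma != 0,
        f \Po (alpha *: 'X + beta%:P) = gamma *: f
      & rho =1 pair_endo (alpha *: varX K + beta%:MP)
                         (gamma *: varY K + polyInX p)].
Proof.
split=> [rhoP|[alpha [beta [gamma [p [alpha_neq0 gamma_neq0 fl rhoE]]]]]].
  have [alpha [beta [alpha_neq0 rhoX]]] := isotropy_varX charK f_neq0 rhoP.
  have [gamma [p [gamma_neq0 fl rhoY]]] :=
    isotropy_varY charK f_neq0 alpha_neq0 rhoP rhoX.
  exists alpha, beta, gamma, p; split=> //.
  by apply: eq_endo; rewrite ?pair_endoX ?pair_endoY // rhoX polyInX_affine.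
have rhoX : rho (varX K) = polyInX (alpha *: 'X + beta%:P).
  by rewrite rhoE pair_endoX polyInX_affine.
have rhoY : rho (varY K) = gamma *: varY K + polyInX p.
  by rewrite rhoE pair_endoY.
split.
  apply: eq_bij (pair_endo_triangular_bij beta p alpha_neq0 gamma_neq0) _ _.
  by move=> a; rewrite rhoE.
apply: commute_derivation.
  by rewrite fdY_varX rmorph0 rhoX /= mderivY_polyInX mulr0.
(* On Y both sides equal gamma f: on the left by the relation [fl], on the right because D kills
   p(X). *)
rewrite fdY_varY endo_polyInX rhoX horner_alg_polyInX fl rhoY.
rewrite linearD linearZ fdY_varY /= mderivY_polyInX mulr0 addr0.
by rewrite /polyInX linearZ /= mulr_algl.
Qed.
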